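(* Consider the block algorithm with FTPL described in the context, for SumLoss with relevance feedback on the top $k$ ranked items at the end of each round ($1\le k\le m$), with number of blocks $K$ of order $\frac{m^{1/3}T^{2/3}}{\lceil m/k\rceil^{2/3}}$ and $\epsilon$ of order $\frac{1}{\sqrt{mK}}$. Then for any sequence of relevance vectors $R_1,\dots,R_T\in\{0,1\}^m$, $$\mathbb{E}\Big[\sum_{t=1}^T\mathrm{SumLoss}(\sigma_t,R_t)\Big]-\min_\sigma\sum_{t=1}^T\mathrm{SumLoss}(\sigma,R_t)\ \le\ O\big(m^{7/3}\lceil m/k\rceil^{1/3}T^{2/3}\big).$$ Precisely: for all constants $0<a_1\le a_2$ there is a constant $c$, depending only on $a_1,a_2$, such that for all $m,k,T$, all admissible $K$ with $a_1 \le K\lceil m/k\rceil^{2/3}/(m^{1/3}T^{2/3})\le a_2$, and all $\epsilon$ with $a_1\le \epsilon\sqrt{mK}\le a_2$, the left-hand side is at most $c\,m^{7/3}\lceil m/k\rceil^{1/3}T^{2/3}$.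
   Context: A permutation $\sigma$ of the items $1,\dots,m$ maps ranks to items, $\sigma^{-1}$ maps items to ranks; $\mathrm{SumLoss}(\sigma,R)=\sum_{i=1}^m\sigma^{-1}(i)R(i)$. Online game with oblivious adversary over $T$ rounds: at round $t$ the learner outputs $\sigma_t$, suffers $\mathrm{SumLoss}(\sigma_t,R_t)$ and observes only $R_t(\sigma_t(1)),\dots,R_t(\sigma_t(k))$ (top $k$ feedback). Algorithm (RTop-kF with Follow The Perturbed Leader), with parameters $K$, $\epsilon>0$. Divide $\{1,\dots,T\}$ into $K$ equal sized consecutive blocks $B_1,\dots,B_K$; $K$ is admissible if it is a positive integer dividing $T$ with $T/K\ge\lceil m/k\rceil$. Divide the items into $\lceil m/k\rceil$ cells of $k$ distinct items each (the last may have fewer). Set $\hat s_0=\mathbf{0}\in\mathbb{R}^m$. For $i=1,\dots,K$: select time points $i_1,\dots,i_{\lceil m/k\rceil}$ from $B_i$ uniformly at random without replacement. For $t\in B_i$: if $t=i_j$ (exploration), output any permutation placing the items of the $j$th cell in the top positions and observe their relevances; otherwise (exploitation) sample $p_t$ uniformly from $[0,1/\epsilon]^m$ (independently) and output $\sigma_t=M(\hat s_{i-1}+p_t)$, where $M(y)=\arg\min_\sigma \sigma^{-1}\cdot y$. At the end of block $i$ let $\hat R_i\in\mathbb{R}^m$ be the vector of the $m$ relevances collected in the exploration rounds of the block, and set $\hat s_i=\hat s_{i-1}+\hat R_i$. *)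

(* Defs.v *)
From HB Require Import structures.
From mathcomp Require Import all_boot all_order all_algebra all_fingroup.
From mathcomp Require Import all_classical all_reals all_analysis.

Set Implicit Arguments.
Unset Strict Implicit.
Unset Printing Implicit Defensive.

Import Order.TTheory GRing.Theory Num.Theory.

Local Open Scope classical_set_scope.
Local Open Scope ring_scope.

(* Items and ranks are both indexed by ['I_m], counted from 0.  A permutation
   [s : 'S_m] maps ranks to items; [(s^-1)%g] maps items to ranks. *)

(* The rank is shifted by one, so that the top item has weight 1. *)
Definition SumLoss (R : realType) (m : nat) (s : 'S_m) (y : 'I_m -> R) : R :=
  \sum_(x < m) ((s^-1)%g x).+1%:R * y x.

(* The default value of the iterated minimum is the value at the identity, so
   this is the minimum over the (nonempty) set of all permutations. *)
Definition best_SumLoss (R : realType) (m T : nat) (rel : 'I_T -> 'I_m -> R)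
  : R :=
  \big[Num.min / \sum_(t < T) SumLoss 1%g (rel t)]_(s : 'S_m)
    \sum_(t < T) SumLoss s (rel t).

(* [s] realizes M(y) = argmin_s s^-1 . y, a dot product which has the same
   formula as [SumLoss]. *)
Definition is_argmin (R : realType) (m : nat) (y : 'I_m -> R) (s : 'S_m)
  : Prop :=
  forall s' : 'S_m, SumLoss s y <= SumLoss s' y.

(* The values y(s(1)), ..., y(s(k)), in this order. *)
Definition top_feedback (R : realType) (m k : nat) (s : 'S_m) (y : 'I_m -> R)
  : seq R :=
  take k [seq y (s r) | r <- enum 'I_m].

(* The ceiling of m / k, for k > 0. *)
Definition ncells (m k : nat) : nat := ((m + k.-1) %/ k)%N.

Definition admissible (m k T K : nat) : Prop :=
  [/\ (0 < K)%N, (K %| T)%N & (ncells m k <= T %/ K)%N].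

Definition in_block (T K : nat) (b : 'I_K) (t : 'I_T) : bool :=
  (t %/ (T %/ K) == b)%N.

(* [cell x] is the cell of the item [x].  The last cell then has the remaining
   m - (ncells m k - 1) * k <= k items. *)
Definition cell_division (m k : nat) (cell : 'I_m -> 'I_(ncells m k)) : Prop :=
  forall j : 'I_(ncells m k),
    (j.+1 < ncells m k)%N -> #|[set x | cell x == j]%SET| = k.

Definition cell_on_top (m n : nat) (cell : 'I_m -> 'I_n) (j : 'I_n)
    (s : 'S_m) : Prop :=
  forall x : 'I_m, cell x = j ->
    ((s^-1)%g x < #|[set z | cell z == j]%SET|)%N.

(* Ordered samples without replacement of [n] rounds of block [b]. *)
Definition samples (T K n : nat) (b : 'I_K) : {set {ffun 'I_n -> 'I_T}} :=
  [set v : {ffun 'I_n -> 'I_T} | injectiveb v && [forall j, in_block b (v j)]]%SET.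

(* Mutual independence of a finite family of classes of events. *)
Definition mutually_independent (R : realType) (d : measure_display)
    (Omega : measurableType d) (P : probability Omega R)
    (I : finType) (F : I -> set (set Omega)) : Prop :=
  forall (J : {set I}) (A : I -> set Omega),
    (forall i, i \in J -> F i (A i)) ->
    P (\bigcap_(i in [set i | i \in J]) A i) = (\prod_(i in J) P (A i))%E.

Lemma invr_pos (R : realType) (eps : R) : 0 < eps -> 0 < eps^-1.
Proof. by rewrite invr_gt0. Qed.

Section Algorithm.
Context {R : realType} {d : measure_display} {Omega : measurableType d}.
Context (P : probability Omega R) (m k T K : nat).

(* [tau b w j] is the exploration round of cell [j] in block [b], [p t x] is
   the perturbation of item [x] in round [t], and [sigma t] is the output of
   the learner in round [t]. *)
Context (cell : 'I_m -> 'I_(ncells m k)) (rel : 'I_T -> 'I_m -> R).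
Context (tau : 'I_K -> Omega -> {ffun 'I_(ncells m k) -> 'I_T}).
Context (p : 'I_T -> 'I_m -> {RV P >-> R}) (sigma : 'I_T -> Omega -> 'S_m).

(* The relevance of [x] is read off the feedback of the round exploring the
   cell of [x], at the rank of [x] in the permutation output there. *)
Definition Rhat (b : 'I_K) (w : Omega) (x : 'I_m) : R :=
  let t := tau b w (cell x) in
  nth 0 (top_feedback k (sigma t w) (rel t)) ((sigma t w)^-1%g x).

(* The sum of the estimates of the blocks strictly before [b]. *)
Definition shat (b : 'I_K) (w : Omega) (x : 'I_m) : R :=
  \sum_(b' < K | (b' < b)%N) Rhat b' w x.

(* The events generated by the selection of each block and by each coordinate
   of each perturbation. *)
Definition sources (i : 'I_K + 'I_T * 'I_m) : set (set Omega) :=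
  match i with
  | inl b => [set tau b @^-1` B | B in setT]
  | inr (t, x) => [set p t x @^-1` B | B in measurable]
  end.

(* The uniform law on the cube [0, 1/eps]^m is that of [m] independent uniform
   coordinates.  The perturbations are drawn for all rounds, but only those of
   the exploitation rounds are used.  The permutation output in an exploration
   round is only constrained to place the explored cell on top, and may
   otherwise depend arbitrarily on the outcome. *)
Record RTopkF_FTPL (eps : R) (eps_gt0 : 0 < eps) : Prop := {
  tau_measurable : forall b v, measurable [set w | tau b w = v];
  tau_sample : forall b w, tau b w \in samples T (ncells m k) b;
  tau_uniform : forall b v, v \in samples T (ncells m k) b ->
    P [set w | tau b w = v] = (#|samples T (ncells m k) b|%:R^-1)%:E;
  p_uniform : forall t x (A : set R), measurable A ->
    distribution P (p t x) A = uniform_prob (invr_pos eps_gt0) A;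
  sources_independent : mutually_independent P sources;
  sigma_measurable : forall t s, measurable [set w | sigma t w = s];
  sigma_explore : forall b w j, cell_on_top cell j (sigma (tau b w j) w);
  sigma_exploit : forall b t w, in_block b t ->
    (forall j, t <> tau b w j) ->
    is_argmin (fun x => shat b w x + p t x w) (sigma t w)
}.

End Algorithm.

(* Main.v *)
(* Up to the constant sum_x r(x), SumLoss is a sum over pairs of items: each pair
   pays the relevance of the item which is ranked below the other one.  In an
   exploitation round, z can be above x only if y(z) >= y(x) for the perturbed
   scores y, so that the loss is bounded by a linear function of the relevances
   whose coefficients have mean G(s(x) - s(z)), where s is the current estimate
   and G(u) is the probability that the difference of two independent
   perturbations is at least u.  By linearity and unbiasedness, the relevances of
   the rounds of a block can be replaced by |block| times their estimates, and
   each pair of items becomes a two-expert game with estimated gains in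
   {-1, 0, 1}.  As G is eps-Lipschitz and equal to 1 below -1/eps, a discrete
   antiderivative of 1 - G is a potential showing that the regret of each pair is
   at most 1/eps + eps K.  The total regret is thus at most
     m^2 K ceil(m/k) + (T/K) m^2 (1/eps + eps K),
   the first term being the cost of the exploration. *)

Require Import Defs.
From HB Require Import structures.
From mathcomp Require Import all_boot all_order all_algebra all_fingroup.
From mathcomp Require Import all_classical all_reals all_analysis.
From mathcomp Require Import measurable_realfun ring lra zify.
Set Implicit Arguments.
Unset Strict Implicit.
Unset Printing Implicit Defensive.
Import Order.TTheory GRing.Theory Num.Theory.
Local Open Scope classical_set_scope.
Local Open Scope ring_scope.

(** * Ranks *)

Lemma rankE m (s : 'S_m) (x : 'I_m) :
  (\sum_(z < m) ((s^-1)%g z < (s^-1)%g x))%N = (s^-1)%g x :> nat.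
Proof.
rewrite (reindex_inj (@perm_inj _ s)) /=.
under eq_bigr do rewrite permK.
have := ltn_ord ((s^-1)%g x); move: ((s^-1)%g x : nat) => r rm.
rewrite -(subnKC (ltnW rm)) big_split_ord /= [X in (_ + X)%N]big1 => [|i _].
  by rewrite addn0 (eq_bigr (fun=> 1%N)) ?sum1_card ?card_ord // => i _;
     rewrite /= ltn_ord.
by rewrite /= ltnNge leq_addr.
Qed.

(** By [rankE] the weight of [x] is one plus the number of items above it; the one gives the part
    common to all permutations. *)
Lemma SumLossE (R : realType) m (s : 'S_m) (y : 'I_m -> R) :
  SumLoss s y = \sum_(x < m) y x
    + \sum_(x < m) \sum_(z < m) ((s^-1)%g z < (s^-1)%g x)%N%:R * y x.
Proof.
rewrite /SumLoss -big_split; apply: eq_bigr => x _ /=.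
by rewrite -[in LHS]rankE -add1n natrD mulrDl mul1r -mulr_suml natr_sum.
Qed.

(** Exchange argument: were [x] above [z], swapping the two would strictly decrease the loss, since
    no other item moves. *)
Lemma argmin_rank (R : realType) m (y : 'I_m -> R) (s : 'S_m) x z :
  is_argmin y s -> y x < y z -> ((s^-1)%g z < (s^-1)%g x)%N.
Proof.
move=> smin yxz; have xz : x != z by apply: contraTneq yxz => ->; rewrite ltxx.
have := smin (s * tperm x z)%g.
have E w : ((s * tperm x z)^-1)%g w = (s^-1)%g (tperm x z w).
  by rewrite invMg tpermV permM.
rewrite /SumLoss (bigD1 x) // (bigD1 z) 1?eq_sym //=.
rewrite [leRHS](bigD1 x) // [X in _ <= _ + X](bigD1 z) 1?eq_sym //=.
rewrite !E tpermL tpermR.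
rewrite [X in _ <= _ + (_ + X)](eq_bigr (fun w => ((s^-1)%g w).+1%:R * y w)).
  rewrite !addrA lerD2r => H.
  rewrite ltnNge; apply/negP; rewrite leq_eqVlt => /predU1P[/val_inj/perm_inj/eqP|].
    by rewrite (negbTE xz).
  by rewrite -(ltr_nat R) => ?; rewrite -!natr1 in H; nra.
by move=> w /andP[wx wz]; rewrite E tpermD // eq_sym.
Qed.

Lemma SumLoss_ge0 (R : realType) m (s : 'S_m) (y : 'I_m -> R) :
  (forall x, 0 <= y x) -> 0 <= SumLoss s y.
Proof. by move=> y0; apply: sumr_ge0 => x _; rewrite mulr_ge0. Qed.

Lemma SumLoss_le_sqr (R : realType) m (s : 'S_m) (y : 'I_m -> R) :
  (forall x, 0 <= y x <= 1) -> SumLoss s y <= m%:R ^+ 2.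
Proof.
move=> y01; apply: (@le_trans _ _ (\sum_(x < m) m%:R)); last first.
  by rewrite sumr_const card_ord -[_ *+ _]mulr_natl.
apply: ler_sum => x _; have /andP[y0 y1] := y01 x.
by rewrite -[leRHS]mulr1 ler_pM // ler_nat.
Qed.

(* Ties of [y] are resolved against the learner, so that the bound holds for
   every minimizer and is linear in [r]. *)
Lemma SumLoss_argmin_le (R : realType) m (y r : 'I_m -> R) (s : 'S_m) :
  is_argmin y s -> (forall x, 0 <= r x) ->
  SumLoss s r <= \sum_(x < m) r x
    + \sum_(x < m) \sum_(z < m | z != x) (y x <= y z)%R%:R * r x.
Proof.
move=> smin r0; rewrite SumLossE lerD2l; apply: ler_sum => x _.
rewrite (bigD1 x) //= ltnn mul0r add0r; apply: ler_sum => z zx.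
rewrite ler_wpM2r // ler_nat; case: (ltnP _ ((s^-1)%g x)) => // zxs.
case: leP => // /(argmin_rank smin); lia.
Qed.

Lemma cell_card_le m k (cell : 'I_m -> 'I_(ncells m k)) j :
  (0 < k)%N -> cell_division cell -> (#|[set x | cell x == j]%SET| <= k)%N.
Proof.
move=> k0 div; case: (ltnP j.+1 (ncells m k)) => [/div -> //|jn].
have mk : (m <= ncells m k * k)%N.
  have := divn_eq (m + k.-1) k; have := ltn_pmod (m + k.-1) k0.
  by rewrite /ncells; lia.
have : (\sum_(i < ncells m k) #|[set x | cell x == i]%SET| = m)%N.
  rewrite -[RHS]card_ord -sum1_card (partition_big cell predT) //=.
  (* Here [j] is the last cell: the other cells hold exactly [k] items each, and there are at most
     [ncells m k * k] items in all. *)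
  by apply: eq_bigr => i _; rewrite -sum1_card; apply: eq_bigl => x; rewrite inE.
rewrite (bigD1 j) //= (eq_bigr (fun=> k)); last first.
  move=> i ij; apply: div; have := ltn_ord i; have := ltn_ord j.
  by move: ij; rewrite -val_eqE /=; lia.
rewrite sum_nat_const cardC1 card_ord => E.
have := ltn_ord j; nia.
Qed.

Lemma nth_top_feedback (R : realType) m k (s : 'S_m) (y : 'I_m -> R) x :
  ((s^-1)%g x < k)%N -> nth 0 (top_feedback k s y) ((s^-1)%g x) = y x.
Proof.
move=> xk; rewrite nth_take // (nth_map x) ?size_enum_ord //.
by rewrite nth_ord_enum permKV.
Qed.

(** * Differences of perturbations *)

Section PerturbationDifference.
Context {R : realType} (eps : R) (eps_gt0 : 0 < eps).

Let U := uniform_prob (invr_pos eps_gt0).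

(** The function G of the overview. The measure is finite, so [fine] loses nothing. *)
Definition diff_tail (u : R) : R :=
  fine ((U \x U)%E [set q : R * R | u <= q.2 - q.1]).

Lemma measurable_diff_ge (u : R) :
  measurable [set q : R * R | u <= q.2 - q.1].
Proof.
rewrite (_ : [set _ | _] = (fun q : R * R => q.2 - q.1) @^-1` `[u, +oo[).
  rewrite -[X in measurable X]setTI; apply: measurable_funB => //.
by apply/seteqP; split => q /=; rewrite in_itv /= andbT.
Qed.

Lemma diff_tailE (u : R) :
  (U \x U)%E [set q : R * R | u <= q.2 - q.1] = (diff_tail u)%:E.
Proof.
rewrite fineK //; apply: (fin_num_measure ((U \x U)%E : probability _ R)).
exact: measurable_diff_ge.
Qed.

(** The uniform density on [[0, 1/eps]] is bounded by [eps]. *)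
Lemma uniform_itv_le (c h : R) : 0 <= h ->
  (U [set z | (c <= z < c + h)%R] <= (eps * h)%:E)%E.
Proof.
move=> h0.
have E : [set z | c <= z < c + h] = [set` `[c, c + h[%R].
  by apply/seteqP; split => z /=; rewrite in_itv.
rewrite E /U /uniform_prob.
apply: (@le_trans _ _ (\int[lebesgue_measure]_(x in [set` `[c, c + h[%R]) eps%:E)%E).
  apply: ge0_le_integral => //=.
  - by move=> x _; rewrite lee_fin uniform_pdf_ge0 // invr_gt0.
  - apply/measurable_EFinP; apply: measurable_funTS; exact: measurable_uniform_pdf.
  - move=> x _; rewrite lee_fin /uniform_pdf subr0 invrK; case: ifP => // _.
    exact: ltW.
rewrite integral_cst //= lebesgue_measure_itv /= lte_fin.
case: ifP => _; last by rewrite mule0 lee_fin mulr_ge0 // ltW.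
by rewrite -EFinB -EFinM lee_fin addrAC subrr add0r.
Qed.

Lemma uniform_cube : U [set z | 0 <= z <= eps^-1] = 1%E :> \bar R.
Proof.
have E : [set z | 0 <= z <= eps^-1] = [set` `[0, eps^-1]%R].
  by apply/seteqP; split => z /=; rewrite in_itv.
rewrite -(@probability_setT _ _ _ U) /U /uniform_prob.
by rewrite [RHS]integral_uniform_pdf setTI E.
Qed.

(** Conditionally on [A], the pair has the law [U \x U] on rectangles, hence on all measurable sets
    by uniqueness of the product measure. *)
Lemma probability_diff_ge d (Omega : measurableType d) (P : probability Omega R)
    (A : set Omega) (X Y : Omega -> R) (u : R) :
  measurable A -> measurable_fun setT X -> measurable_fun setT Y ->
  (forall B C, measurable B -> measurable C ->
    P (A `&` (X @^-1` B `&` Y @^-1` C)) = (P A * (U B * U C))%E) ->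
  P (A `&` [set w | u <= Y w - X w]) = (P A * (diff_tail u)%:E)%E.
Proof.
move=> mA mX mY PA.
pose XY w : measurableTypeR R * measurableTypeR R := (X w, Y w).
have mXY : measurable_fun setT XY by exact: measurable_fun_pair.
have mS : measurable [set w | u <= Y w - X w].
  by rewrite -[X in measurable X]setTI; exact: mXY (measurable_diff_ge u).
(* Conditioning requires [P A] to be nonzero; a null [A] makes both sides vanish. *)
have [PA0|PA0] := eqVneq (P A) 0%E.
  rewrite PA0 mul0e; apply/eqP; rewrite eq_le measure_ge0 andbT -PA0.
  by apply: le_measure; rewrite ?inE //; exact: measurableI.
have PAfin : P A \is a fin_num by exact: fin_num_measure.
have f0 : 0 < fine (P A) by rewrite fine_gt0 // lt0e PA0 measure_ge0 /= ltey_eq PAfin.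
have i0 : 0 <= (fine (P A))^-1 by rewrite invr_ge0 ltW.
(* The law of [XY] conditionally on [A]: restriction to [A], image by [XY], division by [P A]. *)
pose m' : {measure set _ -> \bar R} :=
  mscale (NngNum i0) (pushforward (mrestr P mA) XY).
have PAK : ((NngNum i0)%:num%:E * P A = 1)%E.
  by rewrite /= -{2}(fineK PAfin) -EFinM mulVf // gt_eqF.
rewrite -diff_tailE (@product_measure_unique _ _ _ _ _ U U (m' mXY)) /=; last 2 first.
- move=> B C mB mC; rewrite /mscale /= /pushforward /mrestr.
  have -> : XY @^-1` (B `*` C) `&` A = A `&` (X @^-1` B `&` Y @^-1` C).
    by apply/seteqP; split => w /=; tauto.
  by rewrite PA // muleA PAK mul1e.
- exact: measurable_diff_ge.
by rewrite /mscale /pushforward /mrestr muleA [(P A * _)%E]muleC PAK mul1e setIC.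
Qed.

Lemma diff_tail_ge0 (u : R) : 0 <= diff_tail u.
Proof. by rewrite fine_ge0. Qed.

Lemma diff_tail_le1 (u : R) : diff_tail u <= 1.
Proof.
rewrite -lee_fin -diff_tailE; apply: (@probability_le1 _ _ _ (U \x U)%E).
exact: measurable_diff_ge.
Qed.

(** The two events differ by the band [S], whose sections at fixed [q.1] are intervals of length
    [h], of mass at most [eps * h]. *)
Lemma diff_tail_lipschitz (u h : R) :
  0 <= h -> diff_tail u <= diff_tail (u + h) + eps * h.
Proof.
move=> h0; rewrite -lee_fin EFinD -!diff_tailE.
set S := [set q : R * R | u <= q.2 - q.1 < u + h].
have mS : measurable S.
  rewrite (_ : S = [set q : R * R | u <= q.2 - q.1] `\`
                   [set q : R * R | u + h <= q.2 - q.1]).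
    by apply: measurableD; exact: measurable_diff_ge.
  apply/seteqP; split => q; rewrite /S /=; first by case/andP => -> /lt_geF ->.
  by case=> -> /negP; rewrite -ltNge => ->.
apply: (@le_trans _ _ ((U \x U)%E ([set q : R * R | u + h <= q.2 - q.1] `|` S))).
  apply: le_measure; rewrite ?inE; [exact: measurable_diff_ge| |].
    by apply: measurableU => //; exact: measurable_diff_ge.
  move=> q /= uq; case: (leP (u + h) (q.2 - q.1)) => H; first by left.
  by right; rewrite /S /= uq.
have := measureU2 ((U \x U)%E : probability _ R) (measurable_diff_ge (u + h)) mS.
move/le_trans; apply.
apply: leeD => //; rewrite /product_measure1.
apply: (@le_trans _ _ (\int[U]_a (eps * h)%:E)%E).
  apply: ge0_le_integral => //=.
  - exact: measurable_fun_xsection.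
  - move=> a _; rewrite (_ : xsection S a = [set z | a + u <= z < (a + u) + h]).
      exact: uniform_itv_le.
    apply/seteqP; split => z /=; rewrite /xsection /= inE /S /=; lra.
by rewrite integral_cst // [X in (_ * X)%E](@probability_setT _ _ _ U) mule1.
Qed.

(** Two points of [[0, 1/eps]] differ by at most [1/eps], and the square [C * C] has full mass. *)
Lemma diff_tail_eq1 (u : R) : u <= - eps^-1 -> diff_tail u = 1.
Proof.
move=> ue; apply/eqP; rewrite eq_le diff_tail_le1 -lee_fin -diff_tailE.
set C := [set z | 0 <= z <= eps^-1].
have mC : measurable C.
  by rewrite (_ : C = [set` `[0, eps^-1]%R]) //;
     apply/seteqP; split => z /=; rewrite in_itv.
have <- : (U \x U)%E (C `*` C) = 1%E.
  have UC : U C = 1%E := uniform_cube.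
  transitivity (U C * U C)%E; first exact: product_measure1E.
  by rewrite UC mule1.
apply: le_measure; rewrite ?inE; [exact: measurableX|exact: measurable_diff_ge|].
by move=> [a b] [] /=; rewrite /C /=; lra.
Qed.

(** By symmetry the second term is the probability of [q.2 - q.1 <= u], an event that meets the
    first one only in the line [q.2 - q.1 = u]. *)
Lemma diff_tailN (u : R) : diff_tail u + diff_tail (- u) <= 1.
Proof.
have swap : (U \x U)%E [set q : R * R | - u <= q.1 - q.2] = (diff_tail (- u))%:E.
  have := @probability_diff_ge _ _ (U \x U)%E setT snd fst (- u).
  rewrite setTI (@probability_setT _ _ _ (U \x U)%E) mul1e; apply=> // B C mB mC.
  rewrite setTI mul1e muleC.
  have -> : snd @^-1` B `&` fst @^-1` C = C `*` B :> set (R * R).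
    by apply/seteqP; split => q [].
  exact: product_measure1E.
(* Raising the threshold [u] by [e / eps] makes the two events disjoint and costs at most [e] by the
   Lipschitz bound. *)
apply/ler_addgt0Pr => e e0.
have h0 : 0 < e / eps by rewrite divr_gt0.
have mN : measurable [set q : R * R | - u <= q.1 - q.2].
  rewrite (_ : [set _ | _] = (fun q : R * R => q.1 - q.2) @^-1` `[- u, +oo[).
    by rewrite -[X in measurable X]setTI; apply: measurable_funB.
  by apply/seteqP; split => q /=; rewrite in_itv /= andbT.
have /= := diff_tail_lipschitz u (ltW h0).
rewrite mulrCA divff ?gt_eqF // mulr1 => H.
have mG := measurable_diff_ge (u + e / eps).
have le1 : diff_tail (u + e / eps) + diff_tail (- u) <= 1.
  rewrite -lee_fin EFinD -[X in (_ + X)%E]swap -[X in (X + _)%E]diff_tailE.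
  have <- := @measureU _ _ _ ((U \x U)%E : probability _ R) _ _ mG mN.
    exact: (probability_le1 ((U \x U)%E : probability _ R) (measurableU _ _ mG mN)).
  by apply/seteqP; split => q //= []; clear -h0; lra.
by rewrite (le_trans (lerD H (lexx _))) // addrAC lerD2r.
Qed.

End PerturbationDifference.

(** * Two-expert games and averages over exploration plans *)

Lemma two_expert_nat (R : realType) (F : R -> R) (c e : R) (K : nat)
    (d : nat -> R) :
  0 <= c -> 0 <= e -> (forall u, 0 <= F u <= 1) ->
  (forall u, u <= - c -> F u = 0) -> (forall u, F (u + 1) <= F u + e) ->
  (forall i, [\/ d i = -1, d i = 0 | d i = 1]) ->
  \sum_(i < K) - F (\sum_(j < i) d j) * d i <= c + e * K%:R.
Proof.
move=> c0 e0 F01 F0 Fe dE.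
(* A discrete antiderivative of [F]: the sum telescopes, up to an error [e] for
   each downward step. *)
pose Psi M D := \sum_(j < M) F (D - j.+1%:R).
(* Shifting the argument by one gains the term [F D] and loses the last term. *)
have PsiS M D : Psi M (D + 1) + F (D - M%:R) = F D + Psi M D.
  elim: M => [|M IH]; first by rewrite /Psi !big_ord0 add0r addr0 subr0.
  rewrite /Psi !big_ord_recr /= -!/(Psi _ _).
  rewrite addrA -IH; congr (_ + _ + _); congr F; rewrite -natr1; ring.
have Psi_ge0 M D : 0 <= Psi M D.
  by apply: sumr_ge0 => j _; have /andP[] := F01 (D - j.+1%:R).
(* Only the indices with [j + 1 < c] contribute, each at most 1. *)
have Psi0 M : Psi M 0 <= c.
  elim: M => [|M IH]; first by rewrite /Psi big_ord0.
  case: (lerP c M.+1%:R) => cM.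
    by rewrite /Psi big_ord_recr /= F0 ?addr0 // sub0r lerN2.
  apply: le_trans (ltW cM); rewrite -[X in _ <= X%:R]card_ord -sum1_card natr_sum.
  by apply: ler_sum => j _; have /andP[] := F01 (0 - j.+1%:R).
(* So large that the boundary term [F (D - 1 - M)] vanishes whenever [D <= K]; this is why the
   induction below also carries the bound on the partial sums. *)
pose M := (K + Num.bound c)%N.
have MK : K%:R + c <= M%:R.
  by rewrite /M natrD lerD2l ltW // archi_boundP.
suff main n : (n <= K)%N ->
    \sum_(i < n) - F (\sum_(j < i) d j) * d i
      <= Psi M 0 - Psi M (\sum_(j < n) d j) + e * n%:R
    /\ \sum_(j < n) d j <= n%:R.
  have [H _] := main K (leqnn K); apply: (le_trans H); rewrite lerD2r.
  by have := Psi0 M; have := Psi_ge0 M (\sum_(j < K) d j); lra.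
elim: n => [_|n IH nK]; first by rewrite !big_ord0 mulr0 subrr addr0.
have [H1 H2] := IH (ltnW nK); move: H1 H2.
rewrite !big_ord_recr /=; set D := \sum_(j < n) d j; move=> H1 H2.
have nKR : n%:R + 1 <= K%:R :> R by rewrite natr1 ler_nat.
rewrite -natr1 mulrDr mulr1.
case: (dE n) => ->; split; try lra.
- have := PsiS M (D - 1); rewrite subrK F0; last by lra.
  by have := Fe (D - 1); rewrite subrK; lra.
- by rewrite addr0; lra.
- have := PsiS M D; have /andP[] := F01 (D - M%:R); lra.
Qed.

Lemma two_expert (R : realType) (F : R -> R) (c e : R) (K : nat)
    (d : 'I_K -> R) :
  0 <= c -> 0 <= e -> (forall u, 0 <= F u <= 1) ->
  (forall u, u <= - c -> F u = 0) -> (forall u, F (u + 1) <= F u + e) ->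
  (forall i, [\/ d i = -1, d i = 0 | d i = 1]) ->
  \sum_(i < K) - F (\sum_(j < K | (j < i)%N) d j) * d i <= c + e * K%:R.
Proof.
move=> c0 e0 F01 F0 Fe dE.
(* Beyond [K] the increments are 0, which is an allowed value. *)
pose d' i := oapp d 0 (insub i).
have d'E (i : 'I_K) : d' i = d i by rewrite /d' valK.
have := @two_expert_nat R F c e K d' c0 e0 F01 F0 Fe.
rewrite (eq_bigr (fun i : 'I_K => - F (\sum_(j < K | (j < i)%N) d j) * d i)).
  by apply=> i; rewrite /d'; case: insubP => [j _ _|_] /=; [exact: dE|constructor 2].
move=> i _; rewrite d'E (big_ord_widen _ d' (ltnW (ltn_ord i))).
by congr (- F _ * _); apply: eq_bigr => j _.
Qed.

(** Each unordered pair is counted once, with [x] the item that [s] ranks below [z]. *)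
Lemma pair_sum_rank (R : realType) m (s : 'S_m) (a : 'I_m -> 'I_m -> R) :
  \sum_(x < m) \sum_(z < m | z != x) a x z =
  \sum_(x < m) \sum_(z < m | ((s^-1)%g z < (s^-1)%g x)%N) (a x z + a z x).
Proof.
have E x : \sum_(z < m | z != x) a x z =
    \sum_(z < m | ((s^-1)%g z < (s^-1)%g x)%N) a x z
    + \sum_(z < m | ((s^-1)%g x < (s^-1)%g z)%N) a x z.
  rewrite (bigID (fun z => (s^-1)%g z < (s^-1)%g x)%N) /=; congr (_ + _).
    apply: eq_bigl => z; case: eqVneq => [->|//]; by rewrite ltnn.
  apply: eq_bigl => z; rewrite -leqNgt [RHS]ltn_neqAle eq_sym; congr (~~ _ && _).
  by rewrite val_eqE (inj_eq perm_inj) eq_sym.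
under eq_bigr do rewrite E.
under [RHS]eq_bigr do rewrite big_split.
rewrite !big_split /=; congr (_ + _).
by rewrite (exchange_big_dep predT).
Qed.

(** * Exploration plans and unbiasedness of the estimates *)

Section BlockAverages.
Context (R : realType) (m k T K : nat).
Context (cell : 'I_m -> 'I_(ncells m k)) (rel : 'I_T -> 'I_m -> R).
Hypotheses (K_gt0 : (0 < K)%N) (K_dvd : (K %| T)%N) (T_gt0 : (0 < T)%N).

Let n := ncells m k.
Let V := {ffun 'I_K -> {ffun 'I_n -> 'I_T}}.

(* A plan fixes the exploration rounds of all the blocks; [plan_weight] is the
   probability of its being selected. *)
Definition plan_weight (v : V) : R :=
  \prod_(b < K) (if v b \in samples T n b then #|samples T n b|%:R^-1 else 0).

(** The values that [Rhat] and, below, [shat] take once the plan is [v]; they no longer involve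
    [sigma]. *)
Definition plan_est (v : V) (b : 'I_K) (x : 'I_m) : R := rel (v b (cell x)) x.

Definition plan_sum (v : V) (b : 'I_K) (x : 'I_m) : R :=
  \sum_(b' < K | (b' < b)%N) plan_est v b' x.

Lemma plan_weight_ge0 v : 0 <= plan_weight v.
Proof. by apply: prodr_ge0 => b _; case: ifP => // _; rewrite invr_ge0. Qed.

Lemma blocksize_gt0 : (0 < T %/ K)%N.
Proof. by rewrite divn_gt0 // dvdn_leq. Qed.

Lemma sum_blocks (F : 'I_T -> R) :
  \sum_(t < T) F t = \sum_(b < K) \sum_(t < T | in_block b t) F t.
Proof.
have tK (t : 'I_T) : (t %/ (T %/ K) < K)%N.
  by rewrite ltn_divLR ?blocksize_gt0 // mulnC divnK.
by rewrite (partition_big (fun t => Ordinal (tK t)) predT).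
Qed.

Lemma card_block (b : 'I_K) : #|[set t : 'I_T | in_block b t]%SET| = (T %/ K)%N.
Proof.
set L := (T %/ K)%N; have L0 : (0 < L)%N := blocksize_gt0.
have TE : T = (K * L)%N by rewrite /L mulnC divnK.
have bT (i : 'I_L) : (b * L + i < T)%N.
  by rewrite TE; have := ltn_ord b; have := ltn_ord i; nia.
have -> : [set t : 'I_T | in_block b t]%SET = [set Ordinal (bT i) | i : 'I_L]%SET.
  apply/setP => t; rewrite inE /in_block; apply/eqP/imsetP => [tb|[i _ ->]] /=.
    have tL : (t %% L < L)%N by rewrite ltn_mod.
    by exists (Ordinal tL) => //; apply: val_inj; rewrite /= -tb -divn_eq.
  by rewrite divnMDl // divn_small ?addn0.
rewrite card_imset ?card_ord // => i j /(congr1 val) /= /addnI; exact: val_inj.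
Qed.

(** The round exploring the cell of [x] is uniform in block [b] and independent of the other blocks,
    the only ones on which [f] depends. *)
Lemma plan_unbiased (f : V -> R) (b : 'I_K) (x : 'I_m) :
  (forall v v' : V, (forall b', b' != b -> v b' = v' b') -> f v = f v') ->
  \sum_v plan_weight v * f v * (\sum_(t < T | in_block b t) rel t x)
  = (T %/ K)%:R * \sum_v plan_weight v * f v * plan_est v b x.
Proof.
move=> fb.
(* The mass, weighted by [f], of the plans exploring the cell of [x] in round [t]: zero outside the
   block and constant on it. *)
pose A t := \sum_(v : V) plan_weight v * f v * (v b (cell x) == t)%:R.
have A0 t : ~~ in_block b t -> A t = 0.
  move=> tb; apply: big1 => v _; case: eqP => [vt|]; last by rewrite mulr0.
  rewrite /plan_weight (bigD1 b) //= ifF ?mul0r //.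
  apply/negbTE; apply: contra tb; rewrite inE => /andP[_ /forallP/(_ (cell x))].
  by rewrite vt.
(* Exchanging two rounds of the block preserves the weights. *)
have AE t t' : in_block b t -> in_block b t' -> A t = A t'.
  move=> tb t'b.
  pose sw (v : V) : V :=
    [ffun b' => if b' == b then [ffun j => tperm t t' (v b j)] else v b'].
  have swK : involutive sw.
    move=> v; apply/ffunP => b'; rewrite !ffunE; case: eqP => [->|//].
    by apply/ffunP => j; rewrite !ffunE eqxx !ffunE tpermK.
  rewrite {1}/A (reindex_inj (inv_inj swK)); apply: eq_bigr => v _.
  have tp u : in_block b (tperm t t' u) = in_block b u.
    by case: tpermP => // ->; rewrite tb t'b.
  have -> : plan_weight (sw v) = plan_weight v.
    apply: eq_bigr => b' _; rewrite ffunE; case: eqP => // ->.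
    rewrite !inE; congr (if _ && _ then _ else _).
      apply/injectiveP/injectiveP => vi i j; last first.
        by rewrite !ffunE => /perm_inj/vi.
      by move=> vij; apply: vi; rewrite !ffunE vij.
    by apply: eq_forallb => j; rewrite ffunE tp.
  have -> : f (sw v) = f v.
    by apply: fb => b' b'b; rewrite ffunE (negbTE b'b).
  rewrite ffunE eqxx ffunE; congr (_ * (nat_of_bool _)%:R).
  by rewrite (can2_eq (tpermK t t') (tpermK t t')) tpermL.
have sumA (g : 'I_T -> R) :
    \sum_v plan_weight v * f v * g (v b (cell x))
    = \sum_(t < T | in_block b t) A t * g t.
  transitivity (\sum_(t < T) A t * g t); last first.
    rewrite [LHS](bigID (in_block b)) /= [X in _ + X]big1 ?addr0 // => t tb.
    by rewrite A0 ?mul0r.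
  under [RHS]eq_bigr do rewrite mulr_suml.
  rewrite exchange_big; apply: eq_bigr => v _ /=.
  rewrite (bigD1 (v b (cell x))) //= eqxx mulr1 [X in _ = _ + X]big1 ?addr0 // => t.
  by rewrite eq_sym => /negbTE ->; rewrite mulr0 mul0r.
rewrite -mulr_suml /plan_est (sumA (fun t => rel t x)).
have -> : \sum_v plan_weight v * f v = \sum_(t < T | in_block b t) A t.
  by have := sumA (fun=> 1); under eq_bigr do rewrite mulr1; move=> ->;
     under eq_bigr do rewrite mulr1.
rewrite [LHS]mulr_sumr [RHS]mulr_sumr; apply: eq_bigr => t tb.
rewrite mulrA; congr (_ * _).
rewrite (eq_bigr (fun=> A t)) => [|t' t'b]; last exact: AE.
have -> : (T %/ K)%N = #|[pred t' : 'I_T | in_block b t']|.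
  by rewrite -(card_block b); apply: eq_card => t'; rewrite inE.
by rewrite sumr_const mulr_natl.
Qed.

Lemma sum_plan_weight : (forall b : 'I_K, (0 < #|samples T n b|)%N) ->
  \sum_v plan_weight v = 1.
Proof.
move=> S0; rewrite /plan_weight.
rewrite -(bigA_distr_bigA (fun b (u : {ffun 'I_n -> 'I_T}) =>
  if u \in samples T n b then #|samples T n b|%:R^-1 else 0 : R)).
apply: big1 => b _; rewrite -big_mkcond /= sumr_const -[LHS]mulr_natl divff //.
by rewrite pnatr_eq0 -lt0n.
Qed.

(** * Regret against a fixed permutation *)

Section Regret.
(** [G] stands for [diff_tail], with [c = 1/eps] and [e = eps]. *)
Context (G : R -> R) (c e : R).
Hypotheses (c_ge0 : 0 <= c) (e_ge0 : 0 <= e) (G01 : forall u, 0 <= G u <= 1).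
Hypotheses (G1 : forall u, u <= - c -> G u = 1).
Hypotheses (G_lip : forall u, G u <= G (u + 1) + e).
Hypotheses (GN : forall u, G u + G (- u) <= 1).
Hypotheses (rel01 : forall t x, rel t x = 0 \/ rel t x = 1).

Lemma plan_est_ge0 v b x : 0 <= plan_est v b x.
Proof. by rewrite /plan_est; case: (rel01 (v b (cell x)) x) => ->. Qed.

(* For each pair of items, the learner plays a two-expert game in which the
   comparator always prefers the item that [s] ranks first. *)
Lemma plan_regret (s : 'S_m) (v : V) :
  \sum_(b < K) \sum_(x < m) \sum_(z < m | z != x)
      G (plan_sum v b x - plan_sum v b z) * plan_est v b x
  <= \sum_(b < K) \sum_(x < m) \sum_(z < m)
       ((s^-1)%g z < (s^-1)%g x)%N%:R * plan_est v b x
     + m%:R ^+ 2 * (c + e * K%:R).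
Proof.
under eq_bigr do rewrite (pair_sum_rank s).
have E b x : \sum_(z < m) ((s^-1)%g z < (s^-1)%g x)%N%:R * plan_est v b x =
    \sum_(z < m | ((s^-1)%g z < (s^-1)%g x)%N) plan_est v b x.
  by rewrite [RHS]big_mkcond; apply: eq_bigr => z _; case: ifP; rewrite ?mul1r ?mul0r.
under [X in _ <= X + _]eq_bigr do under eq_bigr do rewrite E.
rewrite addrC -lerBlDr -sumrB.
under eq_bigr do (rewrite -sumrB; under eq_bigr do rewrite -sumrB).
rewrite exchange_big /=; under eq_bigr do rewrite exchange_big /=.
have ce0 : 0 <= c + e * K%:R by rewrite addr_ge0 // mulr_ge0.
apply: (@le_trans _ _ (\sum_(x < m) \sum_(z < m) (c + e * K%:R))); last first.
  by rewrite !sumr_const card_ord -mulrnA -[leLHS]mulr_natl natrM expr2.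
apply: ler_sum => x _; rewrite big_mkcond /=; apply: ler_sum => z _.
case: ifP => // _.
pose F u := 1 - G u.
pose d b := plan_est v b x - plan_est v b z.
have := @two_expert R F c e K d c_ge0 e_ge0.
have F01 u : 0 <= F u <= 1 by rewrite /F; have /andP[] := G01 u; lra.
have F0 u : u <= - c -> F u = 0 by rewrite /F => /G1 ->; rewrite subrr.
have Fl u : F (u + 1) <= F u + e by rewrite /F; have := G_lip u; lra.
have dE b : [\/ d b = -1, d b = 0 | d b = 1].
  rewrite /d /plan_est; case: (rel01 (v b (cell x)) x) => ->;
    case: (rel01 (v b (cell z)) z) => ->; rewrite ?subrr ?subr0 ?sub0r.
  - by constructor 2.
  - by constructor 1.
  - by constructor 3.
  - by constructor 2.
move=> /(_ F01 F0 Fl dE); apply: le_trans; apply: ler_sum => b _.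
have -> : \sum_(j < K | (j < b)%N) d j = plan_sum v b x - plan_sum v b z.
  by rewrite /d sumrB.
set D := plan_sum v b x - plan_sum v b z.
have -> : plan_sum v b z - plan_sum v b x = - D by rewrite opprB.
(* By [GN] the learner pays at most [G D * q + (1 - G D) * p] for the pair, which exceeds the
   comparator's [q] by [- F D * (q - p)]. *)
rewrite /F /d; have := GN D; have := plan_est_ge0 v b z.
set p := plan_est v b z; set q := plan_est v b x => p0 GND.
have := ler_wpM2r p0 GND; rewrite mulrDl mul1r; lra.
Qed.

(** [plan_regret] is averaged over the plans, after [plan_unbiased] has turned true relevances into
    estimates for the learner and the comparator alike. *)
Lemma expected_plan_regret (s : 'S_m) :
  (forall b : 'I_K, (0 < #|samples T n b|)%N) ->
  \sum_(t < T) \sum_(x < m) rel t x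
  + \sum_(b < K) \sum_(t < T | in_block b t) \sum_(x < m) \sum_(z < m | z != x)
      \sum_(v : V) plan_weight v * G (plan_sum v b x - plan_sum v b z) * rel t x
  <= \sum_(t < T) SumLoss s (rel t)
     + (T %/ K)%:R * (m%:R ^+ 2 * (c + e * K%:R)).
Proof.
move=> S0; under [X in _ <= X + _]eq_bigr do rewrite SumLossE.
rewrite big_split /= -addrA lerD2l.
(* Used twice: with the learner's coefficients [G], and with the constant coefficients of [s]. *)
have swap (a : 'I_K -> 'I_m -> 'I_m -> V -> R) (Q : 'I_m -> pred 'I_m) :
    (forall b x z (v v' : V),
       (forall b', b' != b -> v b' = v' b') -> a b x z v = a b x z v') ->
    \sum_(b < K) \sum_(t < T | in_block b t) \sum_(x < m) \sum_(z < m | Q x z)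
       \sum_(v : V) plan_weight v * a b x z v * rel t x
    = (T %/ K)%:R * \sum_(v : V) plan_weight v *
       \sum_(b < K) \sum_(x < m) \sum_(z < m | Q x z) a b x z v * plan_est v b x.
  move=> ab.
  under [in RHS]eq_bigr do rewrite mulr_sumr.
  rewrite [in RHS]exchange_big mulr_sumr; apply: eq_bigr => b _ /=.
  under [in RHS]eq_bigr do rewrite mulr_sumr.
  rewrite [in RHS]exchange_big mulr_sumr exchange_big; apply: eq_bigr => x _ /=.
  under [in RHS]eq_bigr do rewrite mulr_sumr.
  rewrite [in RHS]exchange_big mulr_sumr exchange_big; apply: eq_bigr => z _ /=.
  under [in RHS]eq_bigr do rewrite mulrA.
  rewrite -plan_unbiased; last exact: ab.
  by rewrite exchange_big; apply: eq_bigr => v _; rewrite mulr_sumr.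
rewrite swap; last first.
  (* The coefficients in block [b] only use the estimates of earlier blocks. *)
  move=> b x z v v' vv'; congr (G (_ - _)); apply: eq_bigr => b' b'b;
    by rewrite /plan_est vv' // -val_eqE /= ltn_eqF.
have -> : \sum_(t < T) \sum_(x < m) \sum_(z < m)
         ((s^-1)%g z < (s^-1)%g x)%N%:R * rel t x
    = (T %/ K)%:R * \sum_(v : V) plan_weight v *
       \sum_(b < K) \sum_(x < m) \sum_(z < m)
         ((s^-1)%g z < (s^-1)%g x)%N%:R * plan_est v b x.
  rewrite -(swap (fun _ x z _ => ((s^-1)%g z < (s^-1)%g x)%N%:R) (fun _ => predT)) //.
  rewrite sum_blocks; apply: eq_bigr => b _; apply: eq_bigr => t _.
  apply: eq_bigr => x _; apply: eq_bigr => z _.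
  by rewrite -!mulr_suml sum_plan_weight // mul1r.
rewrite -mulrDr ler_wpM2l //.
set B := _ * (c + _).
have -> : B = \sum_(v : V) plan_weight v * B.
  by rewrite -mulr_suml sum_plan_weight // mul1r.
rewrite -big_split /=.
apply: ler_sum => v _; rewrite -mulrDr ler_wpM2l ?plan_weight_ge0 //.
exact: plan_regret.
Qed.

End Regret.

End BlockAverages.

(** * Expected loss of the learner *)

Section Means.
Context {R : realType} {d : measure_display} {Omega : measurableType d}.
Context (P : probability Omega R).

(** Nonnegativity is included so that means add up without integrability conditions. *)
Definition has_mean (f : Omega -> R) (a : R) : Prop :=
  [/\ measurable_fun setT f, forall w, 0 <= f w
    & (\int[P]_w (f w)%:E)%E = a%:E].

Lemma has_mean_cst (a : R) : 0 <= a -> has_mean (fun=> a) a.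
Proof.
move=> a0; split=> //; have /= -> := @integral_cst _ _ _ P setT measurableT a%:E.
by rewrite probability_setT mule1.
Qed.

Lemma has_mean_indic (A : set Omega) (a : R) :
  measurable A -> P A = a%:E -> has_mean (\1_A) a.
Proof.
move=> mA PA; split=> [|w|]; [exact: measurable_indic|by rewrite indicE|].
by rewrite integral_indic // setIT.
Qed.

Lemma has_meanD (f g : Omega -> R) (a b : R) :
  has_mean f a -> has_mean g b -> has_mean (fun w => f w + g w) (a + b).
Proof.
move=> [mf f0 fa] [mg g0 gb]; split=> [|w|].
- exact: measurable_funD.
- by rewrite addr_ge0.
- rewrite EFinD -fa -gb -ge0_integralD //.
  + by move=> w _; rewrite lee_fin.
  + exact/measurable_EFinP.
  + by move=> w _; rewrite lee_fin.
  + exact/measurable_EFinP.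
Qed.

Lemma has_meanMr (f : Omega -> R) (a c : R) :
  0 <= c -> has_mean f a -> has_mean (fun w => f w * c) (a * c).
Proof.
move=> c0 [mf f0 fa]; split=> [|w|].
- exact: measurable_funM.
- by rewrite mulr_ge0.
- under eq_integral do rewrite mulrC EFinM.
  rewrite ge0_integralZl_EFin //.
  + by rewrite fa -EFinM mulrC.
  + by move=> w _; rewrite lee_fin.
  + exact/measurable_EFinP.
Qed.

Lemma has_mean_sum (I : Type) (r : seq I) (Q : pred I) (f : I -> Omega -> R)
    (a : I -> R) :
  (forall i, Q i -> has_mean (f i) (a i)) ->
  has_mean (fun w => \sum_(i <- r | Q i) f i w) (\sum_(i <- r | Q i) a i).
Proof.
move=> fa; elim: r => [|i r IH].
  under eq_fun do rewrite big_nil; rewrite big_nil; exact: has_mean_cst.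
under eq_fun do rewrite big_cons; rewrite big_cons.
by case: ifP => // Qi; apply: has_meanD => //; exact: fa.
Qed.

Lemma expectation_le_has_mean (f g : Omega -> R) (a : R) :
  measurable_fun setT f -> (forall w, 0 <= f w <= g w) -> has_mean g a ->
  ('E_P[f] <= a%:E)%E.
Proof.
move=> mf fg [mg g0 ga]; rewrite -ga unlock; apply: ge0_le_integral => //.
- by move=> w _; rewrite lee_fin; have /andP[] := fg w.
- exact/measurable_EFinP.
- exact/measurable_EFinP.
- by move=> w _; rewrite lee_fin; have /andP[] := fg w.
Qed.

End Means.

Section Learner.
Context {R : realType} {d : measure_display} {Omega : measurableType d}.
Context (P : probability Omega R) (m k T K : nat).
Context (cell : 'I_m -> 'I_(ncells m k)) (rel : 'I_T -> 'I_m -> R).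
Context (tau : 'I_K -> Omega -> {ffun 'I_(ncells m k) -> 'I_T}).
Context (p : 'I_T -> 'I_m -> {RV P >-> R}) (sigma : 'I_T -> Omega -> 'S_m).
Context (eps : R) (eps_gt0 : 0 < eps).
Hypothesis alg : RTopkF_FTPL cell rel tau p sigma eps_gt0.

Let n := ncells m k.
Let V := {ffun 'I_K -> {ffun 'I_n -> 'I_T}}.
Let U := uniform_prob (invr_pos eps_gt0).

Definition plan_event (v : V) : set Omega := [set w | forall b, tau b w = v b].

Lemma measurable_plan_event v : measurable (plan_event v).
Proof.
rewrite (_ : plan_event v = \bigcap_(b in [set: 'I_K]) [set w | tau b w = v b]).
  apply: fin_bigcap_measurable => // b _; exact: (tau_measurable alg).
by apply/seteqP; split => w H b; [move=> _|]; exact: H.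
Qed.

Lemma tau_eqE b (u : {ffun 'I_n -> 'I_T}) : P [set w | tau b w = u] =
  (if u \in samples T n b then #|samples T n b|%:R^-1 else 0)%:E.
Proof.
case: ifPn => uS; first exact: (tau_uniform alg).
rewrite (_ : [set _ | _] = set0) ?measure0 //.
apply/seteqP; split => w //= wu; move: uS; rewrite -wu.
by rewrite (tau_sample alg b w).
Qed.

Lemma plan_perturbation_indep v t x z (B C : set R) :
  x != z -> measurable B -> measurable C ->
  P (plan_event v `&` (p t x @^-1` B `&` p t z @^-1` C))
  = ((plan_weight R v)%:E * (U B * U C))%E.
Proof.
move=> xz mB mC.
(* Independence is applied to the selections of all blocks and to the coordinates [x] and [z] of one
   perturbation, which are distinct sources as [x != z]. *)
pose J : {set 'I_K + 'I_T * 'I_m} := [set i | match i with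
  | inl _ => true | inr q => (q == (t, x)) || (q == (t, z)) end]%SET.
pose A (i : 'I_K + 'I_T * 'I_m) : set Omega := match i with
  | inl b => tau b @^-1` [set v b]
  | inr q => if q == (t, x) then p t x @^-1` B else p t z @^-1` C end.
have JX : inr (t, x) \in J by rewrite inE eqxx.
have JZ : inr (t, z) \in J by rewrite inE eqxx orbT.
have AX : A (inr (t, x)) = p t x @^-1` B by rewrite /A eqxx.
have zx : ((t, z) == (t, x)) = false.
  by rewrite xpair_eqE eqxx eq_sym; exact: negbTE.
have AZ : A (inr (t, z)) = p t z @^-1` C by rewrite /A zx.
have := sources_independent alg (J := J) (A := A).
have JA i : i \in J -> sources tau p i (A i).
  case: i => [b _|[t' x']]; first by exists [set v b].
  rewrite inE /A /=; case: eqP => [[-> ->] _|_ /= /eqP[-> ->]].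
    by exists B.
  by exists C.
move=> /(_ JA).
have -> : \bigcap_(i in [set i | i \in J]) A i =
    plan_event v `&` (p t x @^-1` B `&` p t z @^-1` C).
  apply/seteqP; split => w.
    move=> H; split; first by move=> b; apply: (H (inl b)); rewrite /= inE.
    by split; [rewrite -AX; exact: H|rewrite -AZ; exact: H].
  move=> [H [HB HC]] [b|[t' x']] /=; first by move=> _; exact: H.
  by rewrite inE /A; case: ifP.
move=> ->; rewrite big_mkcond big_sumType /= -!big_mkcond /=.
congr (_ * _)%E.
  rewrite /plan_weight -prodEFin; apply: eq_big => [b|b _]; first by rewrite inE.
  exact: tau_eqE.
rewrite (bigD1 (t, x)) //= (bigD1 (t, z)) /=; last by rewrite JZ zx.
rewrite big_pred0 ?mule1; last first.
  by move=> q; rewrite inE; case: eqP => //=; case: eqP.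
rewrite eqxx zx.
have := p_uniform alg t x mB; have := p_uniform alg t z mC.
by rewrite /distribution /= /pushforward => -> ->.
Qed.

Lemma plan_perturbation_diff v t x z (u : R) : x != z ->
  P (plan_event v `&` [set w | u <= p t z w - p t x w])
  = (plan_weight R v * diff_tail eps_gt0 u)%:E.
Proof.
move=> xz.
have PV : P (plan_event v) = (plan_weight R v)%:E.
  have := @plan_perturbation_indep v t x z setT setT xz measurableT measurableT.
  have U1 : U setT = 1%E := @probability_setT _ _ _ U.
  by rewrite !preimage_setT !setIT U1 !mule1.
rewrite (probability_diff_ge (eps_gt0 := eps_gt0)) ?PV ?EFinM //.
- exact: measurable_plan_event.
- by move=> B C mB mC; rewrite plan_perturbation_indep.
Qed.

Hypotheses (k_gt0 : (0 < k)%N) (div : cell_division cell).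

(** In the round exploring its cell, [x] has a rank below the size of the cell, hence below [k], and
    its relevance is observed. *)
Lemma RhatE b w x : Rhat cell rel tau sigma b w x
  = plan_est cell rel [ffun b' => tau b' w] b x.
Proof.
rewrite /Rhat /plan_est ffunE nth_top_feedback //.
apply: leq_trans (cell_card_le (cell x) k_gt0 div).
exact: (sigma_explore alg).
Qed.

Lemma shatE b w x : shat cell rel tau sigma b w x
  = plan_sum cell rel [ffun b' => tau b' w] b x.
Proof. by apply: eq_bigr => b' _; rewrite RhatE. Qed.

Hypotheses (K_gt0 : (0 < K)%N) (K_dvd : (K %| T)%N) (T_gt0 : (0 < T)%N).
Hypothesis rel01 : forall t x, rel t x = 0 \/ rel t x = 1.

Let rel_ge0 t x : 0 <= rel t x.
Proof. by case: (rel01 t x) => ->. Qed.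

(** The plan is [v] and the perturbed score of [z] is at least that of [x], so that [x] may be
    ranked below [z]. Fixing the plan makes the threshold deterministic. *)
Let late (v : V) b t x z : set Omega :=
  plan_event v `&`
  [set w | plan_sum cell rel v b x - plan_sum cell rel v b z
             <= p t z w - p t x w].

(** An exploration round is charged the crude bound [m ^ 2], any other round the bound for
    minimizers. *)
Lemma round_loss_le b t w : in_block b t ->
  SumLoss (sigma t w) (rel t) <=
    (t \in codom (tau b w))%:R * m%:R ^+ 2 + \sum_(x < m) rel t x
    + \sum_(x < m) \sum_(z < m | z != x) \sum_(v : V)
        \1_(late v b t x z) w * rel t x.
Proof.
move=> tb.
have late0 : 0 <= \sum_(x < m) \sum_(z < m | z != x) \sum_(v : V)
    \1_(late v b t x z) w * rel t x.
  by do 3!(apply: sumr_ge0 => ? _); rewrite mulr_ge0 // indicE.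
have S0 : 0 <= \sum_(x < m) rel t x by apply: sumr_ge0.
have [_|tc] := boolP (t \in codom (tau b w)).
  rewrite mul1r -addrA ler_wpDr ?addr_ge0 //; apply: SumLoss_le_sqr => x.
  by case: (rel01 t x) => ->; rewrite lexx ler01.
rewrite mul0r add0r.
have opt := sigma_exploit alg (w := w) tb.
have {}opt :
    is_argmin (fun x => shat cell rel tau sigma b w x + p t x w) (sigma t w).
  by apply: opt => j tj; move: tc; rewrite tj codom_f.
apply: (le_trans (SumLoss_argmin_le opt (rel_ge0 t))); rewrite lerD2l.
apply: ler_sum => x _; apply: ler_sum => z _.
(* Only the plan actually selected in [w] is kept. *)
rewrite (bigD1 [ffun b' => tau b' w]) //= ler_wpDr //.
  by apply: sumr_ge0 => v _; rewrite mulr_ge0 // indicE.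
rewrite ler_wpM2r // indicE ler_nat !shatE.
case: leP => // H; rewrite mem_set //; split; first by move=> b'; rewrite ffunE.
by rewrite /= lerBlDr addrAC lerBrDr [leRHS]addrC.
Qed.

Lemma expected_loss_le :
  ('E_P[fun w => (\sum_(t < T) SumLoss (sigma t w) (rel t))%R] <=
  ((K * ncells m k)%:R * m%:R ^+ 2 + (\sum_(t < T) \sum_(x < m) rel t x
   + \sum_(b < K) \sum_(t < T | in_block b t) \sum_(x < m) \sum_(z < m | z != x)
      \sum_(v : V) plan_weight R v *
         diff_tail eps_gt0 (plan_sum cell rel v b x - plan_sum cell rel v b z)
         * rel t x))%:E)%E.
Proof.
apply: (@expectation_le_has_mean _ _ _ _ _ (fun w =>
   (K * ncells m k)%:R * m%:R ^+ 2 + (\sum_(t < T) \sum_(x < m) rel t x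
   + \sum_(b < K) \sum_(t < T | in_block b t) \sum_(x < m) \sum_(z < m | z != x)
      \sum_(v : V) \1_(late v b t x z) w * rel t x))).
- apply: measurable_sum => t.
  (* Measurability: the loss of a round is a finite combination of indicators of the values of
     [sigma t]. *)
  rewrite (_ : (fun w => _) = fun w => \sum_(s : 'S_m)
      \1_[set w | sigma t w = s] w * SumLoss s (rel t)).
    apply: measurable_sum => s; apply: measurable_funM => //.
    apply: measurable_indic; exact: (sigma_measurable alg).
  apply/funext => w; rewrite (bigD1 (sigma t w)) //= indicE mem_set // mul1r.
  rewrite big1 ?addr0 // => s ws; rewrite indicE memNset ?mul0r //= => E.
  by rewrite E eqxx in ws.
- move=> w; apply/andP; split; first by apply: sumr_ge0 => t _; exact: SumLoss_ge0.
  rewrite [leLHS](sum_blocks K_gt0 K_dvd T_gt0).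
  apply: (le_trans (ler_sum _ (fun b _ =>
    ler_sum _ (fun t tb => round_loss_le w tb)))).
  under eq_bigr do rewrite 2!big_split.
  rewrite 2!big_split /= -addrA -(sum_blocks K_gt0 K_dvd T_gt0) lerD2r.
  rewrite natrM -mulrA -[X in X%:R * _]card_ord -sum1_card natr_sum mulr_suml.
  apply: ler_sum => b _; rewrite mul1r -mulr_suml ler_wpM2r ?sqr_ge0 //.
  rewrite -natr_sum ler_nat -[leqRHS]card_ord.
  (* A block has at most [ncells m k] exploration rounds. *)
  apply: leq_trans (leq_image_card (tau b w) _).
  rewrite -sum1_card [leqRHS]big_mkcond [leqLHS]big_mkcond.
  by apply: leq_sum => t _; do 2!case: ifP => //.
- apply: has_meanD; first by apply: has_mean_cst; rewrite mulr_ge0 // sqr_ge0.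
  apply: has_meanD; first by apply: has_mean_cst; do 2!(apply: sumr_ge0 => ? _).
  apply: has_mean_sum => b _; apply: has_mean_sum => t _.
  apply: has_mean_sum => x _; apply: has_mean_sum => z zx.
  apply: has_mean_sum => v _; apply: has_meanMr => //.
  apply: has_mean_indic; last by apply: plan_perturbation_diff; rewrite eq_sym.
  apply: measurableI; first exact: measurable_plan_event.
  have mp : measurable_fun setT (fun w => (p t x w, p t z w)).
    exact: measurable_fun_pair.
  by rewrite -[X in measurable X]setTI; exact: mp (measurable_diff_ge _).
Qed.

End Learner.

(** * Rates *)

(* In terms of [mu = m^(1/6)], [nu = n^(1/3)], [th = T^(1/3)] and [q = K^(1/2)]
   all the quantities are monomials. *)
Lemma rate_monomials (R : realType) (a1 a2 e mu nu th q : R) :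
  0 < a1 -> a1 <= a2 -> 0 < e -> 1 <= mu -> 0 < nu -> 0 < th -> 0 < q ->
  a1 * (mu ^+ 2 * th ^+ 2) <= q ^+ 2 * nu ^+ 2 <= a2 * (mu ^+ 2 * th ^+ 2) ->
  a1 <= e * (mu ^+ 3 * q) <= a2 ->
  q ^+ 2 * nu ^+ 3 * mu ^+ 12
    + th ^+ 3 / q ^+ 2 * (mu ^+ 12 * (e^-1 + e * q ^+ 2))
  <= (a2 + (a1^-1 + a2) / Num.sqrt a1) * mu ^+ 14 * nu * th ^+ 2.
Proof.
move=> a10 a12 e0 mu1 nu0 th0 q0 /andP[K1 K2] /andP[e1 e2].
have mu0 : 0 < mu := lt_le_trans ltr01 mu1.
have a20 : 0 < a2 := lt_le_trans a10 a12.
have s0 : 0 < Num.sqrt a1 by rewrite sqrtr_gt0.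
set C := a1^-1 + a2; have C0 : 0 < C by rewrite addr_gt0 // invr_gt0.
have mu3 : 1 <= mu ^+ 3 by rewrite exprn_ege1.
(* Exploration cost, from the upper bound on [K]. *)
have H1 : q ^+ 2 * nu ^+ 3 * mu ^+ 12 <= a2 * mu ^+ 14 * nu * th ^+ 2.
  have -> : q ^+ 2 * nu ^+ 3 * mu ^+ 12 = q ^+ 2 * nu ^+ 2 * (nu * mu ^+ 12) by ring.
  have -> : a2 * mu ^+ 14 * nu * th ^+ 2
    = a2 * (mu ^+ 2 * th ^+ 2) * (nu * mu ^+ 12) by ring.
  by rewrite ler_pM2r // mulr_gt0 // exprn_gt0.
(* The upper bound on [e] controls [e * q ^+ 2], the lower one [e^-1]; [1 <= mu] absorbs the missing
   powers of [mu]. *)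
have H2 : e^-1 + e * q ^+ 2 <= C * (mu ^+ 3 * q).
  rewrite mulrDl; apply: lerD.
    by rewrite -[leLHS]mul1r ler_pdivrMr // -mulrA mulrC ler_pdivlMr // mul1r mulrC.
  rewrite expr2 mulrA [leRHS]mulrA ler_pM2r //.
  apply: (@le_trans _ _ (e * (mu ^+ 3 * q))).
    by rewrite ler_pM2l // ler_peMl // ltW.
  by rewrite (le_trans e2) // ler_peMr // ltW.
(* The square root of the lower bound on [K], which trades the [1 / q] left in the exploitation cost
   for [nu / (mu * th)]. *)
have H3 : Num.sqrt a1 * (mu * th) <= q * nu.
  rewrite -(@ler_pXn2r _ 2) ?nnegrE ?mulr_ge0 ?(ltW s0) ?(ltW mu0) ?(ltW th0)
    ?(ltW q0) ?(ltW nu0) //.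
  by rewrite !exprMn sqr_sqrtr // ltW.
have H4 : th ^+ 3 / q ^+ 2 * (mu ^+ 12 * (e^-1 + e * q ^+ 2))
    <= C / Num.sqrt a1 * mu ^+ 14 * nu * th ^+ 2.
  apply: (@le_trans _ _ (th ^+ 3 / q ^+ 2 * (mu ^+ 12 * (C * (mu ^+ 3 * q))))).
    by rewrite ler_pM2l ?divr_gt0 ?exprn_gt0 // ler_pM2l ?exprn_gt0.
  have -> : th ^+ 3 / q ^+ 2 * (mu ^+ 12 * (C * (mu ^+ 3 * q)))
    = C * th ^+ 2 * mu ^+ 14 / (Num.sqrt a1 * q) * (Num.sqrt a1 * (mu * th)).
    by field; rewrite !gt_eqF.
  have -> : C / Num.sqrt a1 * mu ^+ 14 * nu * th ^+ 2
    = C * th ^+ 2 * mu ^+ 14 / (Num.sqrt a1 * q) * (q * nu).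
    by field; rewrite !gt_eqF.
  by rewrite ler_pM2l // divr_gt0 ?mulr_gt0 ?exprn_gt0.
by apply: (le_trans (lerD H1 H4)); rewrite -!mulrDl.
Qed.

Lemma rate_bound (R : realType) (a1 a2 e M N T K : R) :
  0 < a1 -> a1 <= a2 -> 0 < e -> 1 <= M -> 0 < N -> 0 < T -> 0 < K ->
  a1 <= K * N `^ (2 / 3) / (M `^ (1 / 3) * T `^ (2 / 3)) <= a2 ->
  a1 <= e * Num.sqrt (M * K) <= a2 ->
  K * N * M ^+ 2 + T / K * (M ^+ 2 * (e^-1 + e * K))
  <= (a2 + (a1^-1 + a2) / Num.sqrt a1) * M `^ (7 / 3) * N `^ (1 / 3) * T `^ (2 / 3).
Proof.
move=> a10 a12 e0 M1 N0 T0 K0.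
have M0 : 0 < M := lt_le_trans ltr01 M1.
have powE (x r s : R) (j : nat) : r = s * j%:R -> x `^ r = (x `^ s) ^+ j.
  by move=> ->; rewrite powRrM powR_mulrn ?powR_ge0.
rewrite (powE M (1 / 3) (1 / 6) 2); last by field.
rewrite (powE M (7 / 3) (1 / 6) 14); last by field.
rewrite (powE N (2 / 3) (1 / 3) 2); last by field.
rewrite (powE T (2 / 3) (1 / 3) 2); last by field.
have ME : M = (M `^ (1 / 6)) ^+ 6.
  by rewrite -(powE M 1); [rewrite powRr1 // ltW|field].
have NE : N = (N `^ (1 / 3)) ^+ 3.
  by rewrite -(powE N 1); [rewrite powRr1 // ltW|field].
have TE : T = (T `^ (1 / 3)) ^+ 3.
  by rewrite -(powE T 1); [rewrite powRr1 // ltW|field].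
have KE : K = Num.sqrt K ^+ 2 by rewrite sqr_sqrtr // ltW.
have mu0 : 0 < M `^ (1 / 6) by exact: powR_gt0.
have mu1 : 1 <= M `^ (1 / 6).
  by rewrite -(@ler_pXn2r _ 6) ?nnegrE ?ler01 ?(ltW mu0) // expr1n -ME.
have nu0 : 0 < N `^ (1 / 3) by exact: powR_gt0.
have th0 : 0 < T `^ (1 / 3) by exact: powR_gt0.
have q0 : 0 < Num.sqrt K by rewrite sqrtr_gt0.
move: (M `^ (1 / 6)) (N `^ (1 / 3)) (T `^ (1 / 3)) (Num.sqrt K)
  ME NE TE KE mu0 mu1 nu0 th0 q0 => mu nu th q -> -> -> -> mu0 mu1 nu0 th0 q0.
rewrite ler_pdivlMr ?ler_pdivrMr ?mulr_gt0 ?exprn_gt0 // => HK.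
rewrite (_ : mu ^+ 6 * q ^+ 2 = (mu ^+ 3 * q) ^+ 2); last by ring.
rewrite sqrtr_sqr ger0_norm ?mulr_ge0 ?exprn_ge0 ?(ltW mu0) ?(ltW q0) // => He.
rewrite -exprM; exact: rate_monomials.
Qed.

Theorem corollary9 (R : realType) (a1 a2 : R) (a1_gt0 : 0 < a1)
    (a1_le_a2 : a1 <= a2) :
  exists c : R,
  forall (m k T K : nat),
    (1 <= k <= m)%N -> admissible m k T K ->
    a1 <= K%:R * (ncells m k)%:R `^ (2 / 3)
            / (m%:R `^ (1 / 3) * T%:R `^ (2 / 3)) <= a2 ->
  forall (eps : R) (eps_gt0 : 0 < eps),
    a1 <= eps * Num.sqrt (m%:R * K%:R) <= a2 ->
  forall (cell : 'I_m -> 'I_(ncells m k)), cell_division cell ->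
  forall (rel : 'I_T -> 'I_m -> R),
    (forall t x, rel t x = 0 \/ rel t x = 1) ->
  forall (d : measure_display) (Omega : measurableType d)
    (P : probability Omega R)
    (tau : 'I_K -> Omega -> {ffun 'I_(ncells m k) -> 'I_T})
    (p : 'I_T -> 'I_m -> {RV P >-> R})
    (sigma : 'I_T -> Omega -> 'S_m),
    RTopkF_FTPL cell rel tau p sigma eps_gt0 ->
  ('E_P[fun w => (\sum_(t < T) SumLoss (sigma t w) (rel t))%R]
     - (best_SumLoss rel)%:E
   <= (c * m%:R `^ (7 / 3) * (ncells m k)%:R `^ (1 / 3)
         * T%:R `^ (2 / 3))%:E)%E.
Proof.
(* The first summand pays for exploration, the second for exploitation. *)
exists (a2 + (a1^-1 + a2) / Num.sqrt a1).
move=> m k T K /andP[k0 km] [K0 KT nL] HK eps eps0 He cell div rel rel01.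
move=> d Omega P tau p sigma alg.
have n0 : (0 < ncells m k)%N by rewrite /ncells divn_gt0 //; lia.
have T0 : (0 < T)%N.
  by case: (posnP T) => // T0; move: nL; rewrite T0 div0n leqNgt n0.
(* A probability space has an outcome, at which [tau] exhibits a sample. *)
have S0 (b : 'I_K) : (0 < #|samples T (ncells m k) b|)%N.
  have [w _] : [set: Omega] !=set0.
    apply/set0P/eqP => O0; have := probability_setT P.
    by rewrite O0 measure0 => -[] /eqP; rewrite eq_sym oner_eq0.
  by apply/card_gt0P; exists (tau b w); exact: (tau_sample alg).
have rate := rate_bound a1_gt0 a1_le_a2 eps0 _ _ _ _ HK He.
move: rate; rewrite ler1n !ltr0n => /(_ (leq_trans k0 km) n0 T0 K0) rate.
have loss := expected_loss_le alg k0 div K0 KT T0 rel01.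
set X := (X in (_ <= X%:E)%E) in loss.
apply: (le_trans (leeB loss (lexx _))); rewrite -EFinB lee_fin.
apply: le_trans rate; rewrite lerBlDr -lerBlDl.
have bound (s : 'S_m) : X - (K%:R * (ncells m k)%:R * m%:R ^+ 2
    + T%:R / K%:R * (m%:R ^+ 2 * (eps^-1 + eps * K%:R)))
    <= \sum_(t < T) SumLoss s (rel t).
  rewrite /X natrM.
  have := @expected_plan_regret R m k T K cell rel K0 KT T0 (diff_tail eps0)
    eps^-1 eps (ltW _) (ltW eps0).
  rewrite invr_gt0 => /(_ eps0).
  have G01 u : 0 <= diff_tail eps0 u <= 1 by rewrite diff_tail_ge0 diff_tail_le1.
  move=> /(_ G01 (@diff_tail_eq1 _ _ eps0)).
  have Gl u : diff_tail eps0 u <= diff_tail eps0 (u + 1) + eps.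
    by have := diff_tail_lipschitz eps0 u ler01; rewrite mulr1.
  move=> /(_ Gl (diff_tailN eps0) rel01 s S0).
  have -> : (T %/ K)%N%:R = T%:R / K%:R :> R.
    by rewrite -{2}(divnK KT) natrM mulfK // pnatr_eq0 -lt0n.
  by rewrite opprD addrACA subrr add0r lerBlDr.
(* The default value of the minimum is the loss of the identity, so [bound] covers it too. *)
rewrite /best_SumLoss; apply/bigmin_geP; split=> [|s _]; exact: bound.
Qed.
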